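(* Let $\mathcal{P}$ be a finitely characterized, stationary, ergodic, finite-alphabet process. Then the history $\epsilon$-machine $M_h(\mathcal{P})$, when considered as a hidden Markov model, is also a generator $\epsilon$-machine. Moreover, the process $\mathcal{P}'$ generated by $M_h(\mathcal{P})$ is the same as the original process $\mathcal{P}$.
   Context: Processes. For a finite alphabet $\mathcal{X}$, $\mathcal{X}^*$ is the set of words over $\mathcal{X}$ of finite positive length; $|w|$ is the length of $w$. A process over $\mathcal{X}$ is a probability space $(\mathcal{X}^{\mathbb{Z}},\mathbb{X},\mathbb{P})$, where $\mathbb{X}$ is generated by the cylinders $A_{w,t}=\{(x_s)_{s\in\mathbb{Z}}: x_t\cdots x_{t+|w|-1}=w\}$. It is stationary if $\mathbb{P}$ is shift invariant, and ergodic if every shift-invariant event has probability $0$ or $1$. For stationary processes $\mathbb{P}(w):=\mathbb{P}(A_{w,t})$ (any $t$), and $\mathbb{P}(w|v):=\mathbb{P}(vw)/\mathbb{P}(v)$ if $\mathbb{P}(v)>0$. A stationary process is determined by its word probabilities $\mathbb{P}(w)$. Hidden Markov models. An (edge-emitting) HMM is a triple $(\mathcal{S},\mathcal{X},\{T^{(x)}\}_{x\in\mathcal{X}})$ with $\mathcal{S}=\{\sigma_1,\dots,\sigma_N\}$ a finite set of states, $\mathcal{X}$ a finite alphabet, and $T^{(x)}$ nonnegative $N\times N$ matrices such that $T=\sum_x T^{(x)}$ is stochastic (rows sum to 1). $T^{(x)}_{ij}$ is the probability of moving from $\sigma_i$ to $\sigma_j$ while emitting $x$. The associated directed graph has vertices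 $\mathcal{S}$ and an edge $\sigma_i\to\sigma_j$ labeled by symbol $x$ and probability $T^{(x)}_{ij}$ whenever $T^{(x)}_{ij}>0$. For $w=w_0\cdots w_{l-1}$, $T^{(w)}=T^{(w_0)}\cdots T^{(w_{l-1})}$, and $\mathbf{P}_{\sigma_i}(w)=\|e_iT^{(w)}\|_1$ ($e_i$ the $i$th standard basis row vector). If the graph is strongly connected, $T$ has a unique stationary distribution $\pi=\pi T$, and the process generated by the HMM is the stationary ergodic process with $\mathbb{P}(w)=\|\pi T^{(w)}\|_1$ for all $w\in\mathcal{X}^*$. Generator $\epsilon$-machine. An HMM such that: (1) its graph is strongly connected; (2) (unifilarity) for each state $\sigma_i$ and symbol $x$ there is at most one outgoing edge from $\sigma_i$ labeled with $x$; (3) (probabilistically distinct states) for each pair of distinct states $\sigma_i,\sigma_j$ there is $w\in\mathcal{X}^*$ with $\mathbf{P}_{\sigma_i}(w)\neq\mathbf{P}_{\sigma_j}(w)$. History $\epsilon$-machine. Let $\mathcal{P}$ be a stationary ergodic process over a finite alphabet $\mathcal{X}$. Let $\mathcal{X}^-$ be the set of pasts $\overleftarrow{x}=\dots x_{-2}x_{-1}$, with the cylinder $\sigma$-algebra $\mathbb{X}^-$ and the projected measure $\mathbb{P}^-$. Write $\overleftarrow{x}^t=x_{-t}\cdots x_{-1}$. A past is regular if $\mathbb{P}(\overleftarrow{x}^t)>0$ for all $t$ and $\mathbf{P}(w|\overleftarrow{x}):=\lim_{t\to\infty}\mathbb{P}(w|\overleftarrow{x}^t)$ exists for every $w\in\mathcal{X}^*$.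 On regular pasts put $\overleftarrow{x}\sim\overleftarrow{x}'$ iff $\mathbf{P}(w|\overleftarrow{x})=\mathbf{P}(w|\overleftarrow{x}')$ for all $w\in\mathcal{X}^*$; let $\mathcal{E}$ be the set of equivalence classes, and for $E\in\mathcal{E}$ let $\mathbf{P}(w|E)=\mathbf{P}(w|\overleftarrow{x})$ for any $\overleftarrow{x}\in E$, and $\mathbb{P}(E)=\mathbb{P}^-(E)$ (classes are measurable). For $x\in\mathcal{X}$ with $\mathbf{P}(x|E)>0$, $\delta_h(E,x)$ is the class containing $\overleftarrow{x}x$ (the past $\overleftarrow{x}$ with symbol $x$ appended) for $\overleftarrow{x}\in E$; this is well defined. $\mathcal{P}$ is finitely characterized if there are finitely many classes $E_1,\dots,E_N$ with $\mathbb{P}(E_i)>0$ and $\sum_i\mathbb{P}(E_i)=1$; then $\mathcal{E}^+=\{E_1,\dots,E_N\}$. In that case $M_h(\mathcal{P})=(\mathcal{E}^+,\mathcal{X},\{T^{(x)}\})$ with $T^{(x)}_{ij}=\mathbf{P}(x|E_i)$ if $\mathbf{P}(x|E_i)>0$ and $\delta_h(E_i,x)=E_j$, and $T^{(x)}_{ij}=0$ otherwise. *)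

(* Defs.v *)
From HB Require Import structures.
From mathcomp Require Import all_boot all_order all_algebra.
From mathcomp Require Import all_classical all_reals all_analysis.
Import Order.TTheory GRing.Theory Num.Theory.
Import numFieldNormedType.Exports.

Set Implicit Arguments.
Unset Strict Implicit.
Unset Printing Implicit Defensive.

Local Open Scope classical_set_scope.
Local Open Scope ring_scope.

(* Finite alphabets. The distinguished point carries no content: measurable
   types of the library have to be pointed, and an alphabet on which a process
   exists is nonempty. *)
#[short(type="alphabetType")]
HB.structure Definition Alphabet := {T of Finite T & Pointed T}.

(* Words are [seq X]; the empty word is excluded explicitly ([w != [::]])
   wherever words of positive length are meant. *)

Section Process.
Context {R : realType} {X : alphabetType}.

Definition cylinder (w : seq X) (t : int) : set (int -> X) :=
  [set x | mkseq (fun i => x (t + i%:Z)) (size w) = w].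

Definition cylinders : set (set (int -> X)) :=
  [set A | exists2 w : seq X, w != [::] & exists t : int, A = cylinder w t].

Definition process := probability (g_sigma_algebraType cylinders) R.

Definition shift (x : int -> X) : int -> X := fun s => x (s + 1).

Definition stationary (P : process) : Prop :=
  forall A : set (g_sigma_algebraType cylinders),
    measurable A -> P (shift @^-1` A) = P A.

Definition ergodic (P : process) : Prop :=
  forall A : set (g_sigma_algebraType cylinders),
    measurable A -> shift @^-1` A = A -> P A = 0%E \/ P A = 1%E.

(* Two measures on the product space are the same process when they agree on
   the cylinder sigma-algebra; their values on other sets are junk. *)
Definition same_process (P P' : process) : Prop :=
  forall A : set (g_sigma_algebraType cylinders), measurable A -> P A = P' A.

Definition wprob (P : process) (w : seq X) : R := fine (P (cylinder w 0)).

(* P(w | v), junk when P(v) = 0 *)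
Definition condprob (P : process) (w v : seq X) : R :=
  wprob P (v ++ w) / wprob P v.

End Process.

Arguments process R X : clear implicits.

Section Past.
Context {R : realType} {X : alphabetType}.

(* A past ... x_{-2} x_{-1} is encoded as the function k |-> x_{-(k+1)}. *)
Definition past_of (x : int -> X) : nat -> X := fun k => x (Negz k).

(* x_{-t} ... x_{-1} *)
Definition past_word (p : nat -> X) (t : nat) : seq X := rev (mkseq p t).

(* x_{-(k+|w|)} ... x_{-(k+1)} = w *)
Definition past_cylinder (w : seq X) (k : nat) : set (nat -> X) :=
  [set p | rev (mkseq (fun i => p (k + i)%N) (size w)) = w].

Definition past_cylinders : set (set (nat -> X)) :=
  [set A | exists2 w : seq X, w != [::] & exists k, A = past_cylinder w k].

Definition append (p : nat -> X) (x : X) : nat -> X :=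
  fun k => if k is k'.+1 then p k' else x.

Variable P : process R X.

Definition past_measure : set (nat -> X) -> \bar R :=
  pushforward P (past_of : g_sigma_algebraType cylinders ->
                           g_sigma_algebraType past_cylinders).

Definition regular (p : nat -> X) : Prop :=
  (forall t, 0 < wprob P (past_word p t)) /\
  (forall w, w != [::] -> cvgn (fun t => condprob P w (past_word p t))).

Definition future (p : nat -> X) (w : seq X) : R :=
  limn (fun t => condprob P w (past_word p t)).

Definition past_equiv (p q : nat -> X) : Prop :=
  forall w, w != [::] -> future p w = future q w.

Definition class_of_past (p : nat -> X) : set (nat -> X) :=
  [set q | regular q /\ past_equiv p q].

Definition equiv_classes : set (set (nat -> X)) :=
  [set E | exists2 p, regular p & E = class_of_past p].

(* P(w | E): the element of the set {P(w | p) | p in E}, which is a singleton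
   when E is an equivalence class. *)
Definition class_prob (E : set (nat -> X)) (w : seq X) : R :=
  xget 0 [set future p w | p in E].

(* The class of [append p x] for p in E; the union is over identical sets when
   E is an equivalence class and P(x | E) > 0. *)
Definition delta_h (E : set (nat -> X)) (x : X) : set (nat -> X) :=
  \bigcup_(p in E) class_of_past (append p x).

(* The set E^+ of equivalence classes of positive probability. *)
Definition positive_classes : set (set (nat -> X)) :=
  [set E | equiv_classes E /\ (0 < past_measure E)%E].

Definition finitely_characterized : Prop :=
  exists N (E : 'I_N -> set (nat -> X)),
    [/\ injective E, (forall i, positive_classes (E i)) &
        (\sum_(i < N) past_measure (E i))%E = 1%E].

(* An indexing E_1, ..., E_N without repetition of the set E^+. *)
Definition enumerates_positive_classes N (E : 'I_N -> set (nat -> X)) : Prop :=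
  set_bij [set: 'I_N] positive_classes E.

Definition history_machine N (E : 'I_N -> set (nat -> X)) (x : X) : 'M[R]_N :=
  \matrix_(i, j)
    if (0 < class_prob (E i) [:: x]) && `[< delta_h (E i) x = E j >]
    then class_prob (E i) [:: x] else 0.

End Past.

(* A hidden Markov model with states 'I_N is a family T of matrices satisfying
   [is_hmm]. *)
Section HMM.
Context {R : realType} {X : alphabetType} {N : nat}.
Variable T : X -> 'M[R]_N.

Definition is_hmm : Prop :=
  (forall x i j, 0 <= T x i j) /\ (forall i, \sum_j (\sum_x T x) i j = 1).

Definition norm1 (v : 'rV[R]_N) : R := \sum_j `|v 0 j|.

Definition word_mx (w : seq X) : 'M[R]_N :=
  foldr (fun x A => T x *m A) 1%:M w.

Definition state_wprob (i : 'I_N) (w : seq X) : R :=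
  norm1 (delta_mx 0 i *m word_mx w).

Definition hmm_edge : rel 'I_N := fun i j => [exists x, 0 < T x i j].

Definition strongly_connected : Prop := forall i j, connect hmm_edge i j.

Definition unifilar : Prop :=
  forall i x j k, 0 < T x i j -> 0 < T x i k -> j = k.

Definition distinct_states : Prop :=
  forall i j, i != j ->
    exists2 w, w != [::] & state_wprob i w <> state_wprob j w.

Definition generator_epsilon_machine : Prop :=
  [/\ is_hmm, strongly_connected, unifilar & distinct_states].

Definition stationary_distribution (pi : 'rV[R]_N) : Prop :=
  [/\ forall j, 0 <= pi 0 j, \sum_j pi 0 j = 1 & pi = pi *m (\sum_x T x)].

Definition generates (P : process R X) : Prop :=
  [/\ stationary P, ergodic P &
      exists2 pi, unique stationary_distribution pi &
        forall w, w != [::] -> wprob P w = norm1 (pi *m word_mx w)].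

End HMM.

(* Main.v *)
Require Import Defs.
From HB Require Import structures.
From mathcomp Require Import all_boot all_order all_algebra.
From mathcomp Require Import all_classical all_reals all_analysis.
From mathcomp Require Import measurable_realfun zify.
(* [shift] is the shift of bi-infinite sequences, not a translation. *)
Import Defs.

(** Almost every past is regular and lies in one of the classes E_1, ..., E_N;
    write pi_i for the probability of E_i and c_i(w) for P(w | E_i).

    Everything rests on the identity P(past in E_i, w emitted next) =
    pi_i c_i(w), which is [pr_causal_future].  On the event that the past is in
    E_j, the estimates P(w | x_{-t} ... x_{-1}) converge at every point to the
    constant c_j(w), by the definition of regularity, and they are bounded by 1.
    Their integrals over the event that the last symbols are v equal P(vw) as
    soon as t >= |v|, so dominated convergence gives
    P(vw) = sum_j c_j(w) P(last symbols v, past in E_j) ([wprob_cat_causal]).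
    Both sides are measures in the past event, and they agree on a generating
    pi-system, hence the event that the last symbols are v can be replaced by
    any measurable set of pasts, in particular by E_i ([pr_past_future]).

    Appending to a past in E_i a symbol a with c_i(a) > 0 leads into the class
    delta(E_i, a), and c_i(aw) = c_i(a) c_{delta(E_i, a)}(w)
    ([class_prob_cons]).  By stationarity delta(E_i, a) has probability at
    least pi_i c_i(a) > 0, so it is one of the E_j ([next_state]).  The rows of
    the machine then sum to 1, state i emits w with probability c_i(w), and
    distinct classes are distinct states.  Unifilarity holds by construction.

    For strong connectivity, let C be the set of states reachable from i.  The
    event that the past is in a class of C is almost surely contained in its
    preimage under the shift, so ergodicity makes its probability 0 or 1
    ([subinvariant_trivial]).  It is at least pi_i > 0, so it is 1, and no
    class of positive probability can lie outside C.

    Finally pi is stationary for the machine, it is the only stationary vector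
    because the machine is irreducible ([stationary_vector_unique]), and
    sum_i pi_i c_i(w) = P(w) by the identity above.  Two stationary processes
    with the same word probabilities agree on cylinders, hence everywhere. *)

Import Order.TTheory GRing.Theory Num.Theory.
Import numFieldNormedType.Exports.

Set Implicit Arguments.
Unset Strict Implicit.
Unset Printing Implicit Defensive.

Local Open Scope classical_set_scope.
Local Open Scope ring_scope.

(** * Sigma-algebras generated by nested discrete observations *)

Lemma countable_preimage_measurable d (T : measurableType d) (K : countType)
    (h : T -> K) (B : set K) :
  (forall u, measurable (h @^-1` [set u])) -> measurable (h @^-1` B).
Proof.
move=> mh; have -> : h @^-1` B = \bigcup_(u in B) h @^-1` [set u].
  by apply/seteqP; split=> [x Bx|x [u Bu /= ->]] //; exists (h x).
rewrite bigcup_mkcond; apply: countable_bigcupT_measurable => //.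
by move=> i; case: ifP.
Qed.

(** The empty set is added because two atoms may be disjoint. *)
Definition observation_atoms (T K : Type) (h : nat -> T -> K) : set (set T) :=
  [set A | A = set0 \/ exists n u, A = h n @^-1` [set u]].

Lemma observation_atoms_setI (T K : Type) (h : nat -> T -> K) :
  (forall m n, (m <= n)%N -> exists r, forall x, h m x = r (h n x)) ->
  setI_closed (observation_atoms h).
Proof.
move=> nested A B [->|[m [u ->]]]; first by left; rewrite set0I.
move=> [->|[n [v ->]]]; first by left; rewrite setI0.
wlog mn : m n u v / (m <= n)%N.
  by move=> W; case: (leqP m n) => [|/ltnW] mn; [|rewrite setIC]; exact: W.
have [r hr] := nested _ _ mn.
have [ruv|ruv] := EM (r v = u); last first.
  left; rewrite -subset0 => x /= [hu hv]; apply: ruv.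
  by rewrite -hv -hr.
right; exists n, v; apply/seteqP; split=> [x []//|x /= hv]; split => //=.
by rewrite hr hv.
Qed.

(** Each observation is a function of every later one, so two atoms are nested
    or disjoint and the atoms form a pi-system.  Cylinders are not one: two
    overlapping windows intersect in a union of cylinders. *)
Lemma measure_eq_observations (R : realType) (T : pointedType) (K : countType)
    (G : set (set T)) (h : nat -> T -> K)
    (m1 m2 : {measure set (g_sigma_algebraType G) -> \bar R}) :
  (forall m n, (m <= n)%N -> exists r, forall x, h m x = r (h n x)) ->
  (forall n u, <<s G >> (h n @^-1` [set u])) ->
  (forall A, G A -> exists n B, A = h n @^-1` B) ->
  (m1 setT < +oo)%E ->
  (forall n u, m1 (h n @^-1` [set u]) = m2 (h n @^-1` [set u])) ->
  forall A : set (g_sigma_algebraType G), measurable A -> m1 A = m2 A.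
Proof.
move=> nested hG Gh m1T m12.
(* The atoms of the first observation cover the space. *)
pose g k : set T := if unpickle k is Some u then h 0%N @^-1` [set u] else set0.
have gen : <<s G >> = <<s observation_atoms h >>.
  apply/seteqP; split; apply: smallest_sub; try exact: smallest_sigma_algebra.
    move=> A /Gh[n [B ->]].
    apply: (@countable_preimage_measurable _
      (g_sigma_algebraType (observation_atoms h))) => u.
    by apply: sub_sigma_algebra; right; exists n, u.
  move=> A [->|[n [u ->]]]; last exact: hG.
  exact: (@measurable0 _ (g_sigma_algebraType G)).
have gat k : observation_atoms h (g k).
  by rewrite /g; case: unpickle => [u|]; [right; exists 0%N, u|left].
move=> A mA.
apply: (@measure_unique _ _ (g_sigma_algebraType G) (observation_atoms h) g) => //.
- exact: observation_atoms_setI.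
- rewrite -subTset => x _; exists (pickle (h 0%N x)) => //.
  by rewrite /g pickleK.
- by move=> B [->|[n [u ->]]]; rewrite ?measure0.
move=> k; apply: le_lt_trans m1T; apply: le_measure; rewrite ?inE//.
by rewrite /g; case: unpickle => [u|] //; exact: hG.
Qed.

(** * Windows, cylinders and past words *)

Section Windows.
Context {X : alphabetType}.
Implicit Types (x : int -> X) (u v w : seq X) (t : int) (p : nat -> X).
Notation bispace := (g_sigma_algebraType (@cylinders X)).
Notation pastspace := (g_sigma_algebraType (@past_cylinders X)).

Definition window x t n : seq X := mkseq (fun i => x (t + i%:Z)) n.

Lemma size_window x t n : size (window x t n) = n.
Proof. exact: size_mkseq. Qed.

Lemma nth_window (x0 : X) x t n i : (i < n)%N ->
  nth x0 (window x t n) i = x (t + i%:Z).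
Proof. exact: nth_mkseq. Qed.

Lemma window_cat x t m n :
  window x t (m + n) = window x t m ++ window x (t + m%:Z) n.
Proof.
apply: (@eq_from_nth _ point) => [|i]; rewrite ?size_cat !size_window// => imn.
rewrite nth_cat size_window nth_window//; case: ltnP => mi.
  by rewrite nth_window.
by rewrite nth_window; [congr x|]; lia.
Qed.

Lemma window_shift x t n : window (shift x) t n = window x (t + 1) n.
Proof. by apply: eq_mkseq => i; rewrite /shift addrAC. Qed.

(** What makes observations through larger and larger windows nested. *)
Lemma subwindow x s m t n : s <= t -> t + n%:Z <= s + m%:Z ->
  window x t n =
  mkseq (fun i => nth point (window x s m) (`|t - s|%N + i)%N) n.
Proof.
move=> st tns; apply: (@eq_from_nth _ point) => [|i].
  by rewrite size_window size_mkseq.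
rewrite size_window => i_n; rewrite nth_window// nth_mkseq// nth_window; last lia.
by congr x; lia.
Qed.

Lemma cylinder_cat u v t :
  cylinder (u ++ v) t = cylinder u t `&` cylinder v (t + (size u)%:Z).
Proof.
rewrite /cylinder; apply/seteqP; split=> x /=.
all: rewrite -!/(window _ _ _) size_cat window_cat.
  by move/eqP; rewrite eqseq_cat ?size_window// => /andP[/eqP -> /eqP ->].
by move=> [-> ->].
Qed.

Lemma shift_cylinder w t : shift @^-1` cylinder w t = cylinder w (t + 1).
Proof.
by apply/seteqP; split=> x /=; rewrite /cylinder /= -!/(window _ _ _) window_shift.
Qed.

Lemma measurable_cylinder w t : measurable (cylinder w t : set bispace).
Proof.
case: w => [|a w]; last by apply: sub_sigma_algebra; exists (a :: w) => //; exists t.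
by rewrite (_ : cylinder _ _ = setT)//; apply/seteqP; split.
Qed.

Lemma measurable_window_eq t n w :
  measurable ((fun x => window x t n) @^-1` [set w] : set bispace).
Proof.
have [<-|nw] := eqVneq (size w) n; first exact: measurable_cylinder.
rewrite (_ : _ @^-1` _ = set0)//; rewrite -subset0 => x /= xw.
by move: nw; rewrite -xw size_window eqxx.
Qed.

Lemma measurable_window t n (B : set (seq X)) :
  measurable ((fun x => window x t n) @^-1` B : set bispace).
Proof.
apply: (@countable_preimage_measurable _ bispace) => u.
exact: measurable_window_eq.
Qed.

Lemma measurable_shift_preimage (A : set bispace) :
  measurable A -> measurable (shift @^-1` A : set bispace).
Proof.
move=> mA; rewrite -[X in measurable X]setTI.
have mS : @measurable_fun _ _ bispace bispace setT shift.
  apply: (@measurability _ _ bispace bispace _ shift cylinders erefl) => //.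
  move=> _ [_ [w w0 [t ->]] <-]; rewrite setTI shift_cylinder.
  exact: measurable_cylinder.
exact: mS.
Qed.

Lemma size_past_word p n : size (past_word p n) = n.
Proof. by rewrite size_rev size_mkseq. Qed.

Lemma past_word_window x n : past_word (past_of x) n = window x (- n%:Z) n.
Proof.
apply: (@eq_from_nth _ point) => [|i]; rewrite size_past_word ?size_window// => i_n.
rewrite nth_window// nth_rev ?size_mkseq// nth_mkseq; last lia.
by rewrite /past_of; congr x; lia.
Qed.

Lemma past_word_append p a n :
  past_word (append p a) n.+1 = rcons (past_word p n) a.
Proof.
rewrite /past_word -rev_cons; congr rev.
by rewrite /mkseq /= (iotaDl 1 0) -map_comp.
Qed.

Lemma past_wordD p k n :
  past_word p (k + n) = rev (mkseq (fun i => p (k + i)%N) n) ++ past_word p k.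
Proof.
rewrite /past_word -rev_cat /mkseq iotaD map_cat add0n.
by rewrite -[X in iota X n](addn0 k) iotaDl -map_comp.
Qed.

(** One step of the process: the symbol at time 0 is appended to the past. *)
Lemma past_of_shift x : past_of (shift x) = append (past_of x) (x 0).
Proof.
by apply: funext => -[|k]; rewrite /past_of /shift /append; congr x; lia.
Qed.

(** A past word of length k + |w| is written from the oldest symbol on, so the
    block that ends k symbols before the present is its prefix. *)
Lemma past_cylinderE w k :
  past_cylinder w k =
  (fun p => past_word p (k + size w)) @^-1` [set v | take (size w) v = w].
Proof.
rewrite /past_cylinder; apply/seteqP; split=> p /=; rewrite past_wordD take_cat;
  by rewrite size_rev size_mkseq ltnn subnn take0 cats0.
Qed.

Lemma past_cylinder0 w :
  past_cylinder w 0 = (fun p => past_word p (size w)) @^-1` [set w].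
Proof.
rewrite past_cylinderE; apply/seteqP; split=> p /=; rewrite ?add0n => pw.
  by rewrite -[X in _ = X]pw take_oversize// size_past_word.
by rewrite pw take_size.
Qed.

Lemma measurable_past_word_eq n w :
  measurable ((fun p => past_word p n) @^-1` [set w] : set pastspace).
Proof.
have [<-|nw] := eqVneq (size w) n; last first.
  rewrite (_ : _ @^-1` _ = set0)//; rewrite -subset0 => x /= xw.
  by move: nw; rewrite -xw size_past_word eqxx.
case: w => [|a w]; first by rewrite (_ : _ @^-1` _ = setT)//; apply/seteqP; split.
rewrite -past_cylinder0; apply: sub_sigma_algebra.
by exists (a :: w) => //; exists 0%N.
Qed.

Lemma measurable_past_word n (B : set (seq X)) :
  measurable ((fun p => past_word p n) @^-1` B : set pastspace).
Proof.
apply: (@countable_preimage_measurable _ pastspace) => u.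
exact: measurable_past_word_eq.
Qed.

Lemma measurable_past_of : @measurable_fun _ _ bispace pastspace setT past_of.
Proof.
apply: (@measurability _ _ bispace pastspace _ past_of past_cylinders erefl) => //.
move=> _ [_ [w w0 [t ->]] <-]; rewrite setTI past_cylinderE -comp_preimage.
rewrite (_ : _ \o _ = fun x => window x (- (t + size w)%:Z) (t + size w)%N).
  exact: measurable_window.
by apply: funext => x /=; rewrite past_word_window.
Qed.

Lemma measurable_past_of_preimage (A : set pastspace) :
  measurable A -> measurable (past_of @^-1` A : set bispace).
Proof.
by move=> mA; rewrite -[X in measurable X]setTI; exact: measurable_past_of.
Qed.

Lemma past_of_atom w :
  past_of @^-1` ((fun p => past_word p (size w)) @^-1` [set w]) =
  cylinder w (- (size w)%:Z).
Proof. by apply/seteqP; split => x /=; rewrite past_word_window. Qed.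

Lemma past_measure_unique (R : realType)
    (m1 m2 : {measure set pastspace -> \bar R}) :
  (m1 setT < +oo)%E ->
  (forall w, m1 ((fun p => past_word p (size w)) @^-1` [set w]) =
             m2 ((fun p => past_word p (size w)) @^-1` [set w])) ->
  forall A : set pastspace, measurable A -> m1 A = m2 A.
Proof.
move=> m1T m12.
apply: (@measure_eq_observations _ _ _ _ (fun n p => past_word p n)) => //.
- move=> m n mn; exists (drop (n - m)) => p.
  rewrite -[in RHS](subnKC mn) past_wordD drop_size_cat//.
  by rewrite size_rev size_mkseq addKn.
- exact: measurable_past_word_eq.
- move=> _ [w _ [k ->]]; rewrite past_cylinderE.
  by eexists; eexists; reflexivity.
move=> n u; have [<-|nu] := eqVneq (size u) n; first exact: m12.
rewrite (_ : _ @^-1` _ = set0) ?measure0//; rewrite -subset0 => x /= xw.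
by move: nu; rewrite -xw size_past_word eqxx.
Qed.

(** The observations are the windows [-n, n); every cylinder is visible through
    a large enough one. *)
Lemma process_unique (R : realType) (P P' : process R X) :
  (forall w t, P (cylinder w t) = P' (cylinder w t)) -> same_process P P'.
Proof.
move=> PP'.
apply: (@measure_eq_observations _ _ _ _
  (fun n x => window x (- n%:Z) (n + n)%N)) => //.
- move=> m n mn.
  eexists (fun v => mkseq (fun i => nth point v (`|- m%:Z - - n%:Z|%N + i)%N) _).
  by move=> x; apply: subwindow; lia.
- by move=> n u; exact: measurable_window_eq.
- move=> _ [w _ [t ->]]; exists (`|t| + size w)%N.
  exists [set v | mkseq (fun i => nth point v
    (`|t - - (`|t| + size w)%N%:Z|%N + i)%N) (size w) = w].
  by apply/seteqP; split => x /=; (rewrite -subwindow; [by []|lia|lia]).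
- exact: le_lt_trans (probability_le1 P measurableT) (ltry _).
move=> n u; have [nu|nu] := eqVneq (size u) (n + n)%N.
  by rewrite -nu; exact: PP'.
rewrite (_ : _ @^-1` _ = set0) ?measure0//; rewrite -subset0 => x /= xw.
by move: nu; rewrite -xw size_window eqxx.
Qed.

End Windows.

(** * Finite partitions of a probability space *)

Section FinitePartition.
Context d (T : measurableType d) (R : realType) (mu : probability T R).
Local Notation pr A := (fine (mu A)).

Lemma pr_ge0 A : 0 <= pr A.
Proof. exact: fine_ge0. Qed.

Lemma prE A : measurable A -> mu A = (pr A)%:E.
Proof. by move=> mA; rewrite fineK//; exact: fin_num_measure. Qed.

Lemma le_pr A B : measurable A -> measurable B -> A `<=` B -> pr A <= pr B.
Proof.
move=> mA mB AB; apply: fine_le; rewrite ?fin_num_measure//.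
by apply: le_measure; rewrite ?inE.
Qed.

Lemma pr_setID A B : measurable A -> measurable B ->
  pr A = pr (A `&` B) + pr (A `\` B).
Proof.
move=> mA mB; have mI := measurableI _ _ mA mB; have mD := measurableD mA mB.
rewrite -fineD ?fin_num_measure// -measureU// ?setUIDK//.
by rewrite setDE setIACA setICr setI0.
Qed.

Lemma measure_bigcup_fin (I : finType) (B : I -> set T) :
  (forall i, measurable (B i)) -> trivIset setT B ->
  mu (\bigcup_i B i) = (\sum_i mu (B i))%E.
Proof.
move=> mB tB; rewrite measure_fin_bigcup//; last exact: finite_finset.
rewrite [RHS]fsbig_seq ?index_enum_uniq//.
rewrite (_ : [set` index_enum I] = setT)//; apply/seteqP; split=> // i _ /=.
exact: mem_index_enum.
Qed.

Lemma pr_setD_full A B : measurable A -> measurable B -> mu B = 1%E ->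
  mu (A `\` B) = 0%E.
Proof.
move=> mA mB B1; apply/eqP; rewrite eq_le measure_ge0 andbT.
have -> : 0%E = mu (~` B) by rewrite probability_setC// B1 subee.
apply: le_measure; rewrite ?inE; [exact: measurableD|exact: measurableC|].
by move=> x [].
Qed.

(** The pieces cover the space up to a null set only: pasts that lie in no class
    of positive probability have to be tolerated. *)
Lemma pr_partition (I : finType) (B : I -> set T) A :
  measurable A -> (forall i, measurable (B i)) -> trivIset setT B ->
  mu (\bigcup_i B i) = 1%E -> pr A = \sum_i pr (A `&` B i).
Proof.
move=> mA mB tB B1.
have mU : measurable (\bigcup_i B i).
  by apply: fin_bigcup_measurable => //; exact: finite_finset.
rewrite (pr_setID mA mU) pr_setD_full// addr0 setI_bigcupr.
rewrite measure_bigcup_fin; last 2 first.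
- by move=> i; exact: measurableI.
- exact: trivIset_setIl.
by rewrite sum_fine// => i _; rewrite fin_num_measure//; exact: measurableI.
Qed.

End FinitePartition.

(** * Word probabilities of a stationary process *)

Section Words.
Context {R : realType} {X : alphabetType}.
Variable P : process R X.
Hypothesis Pstat : stationary P.
Notation bispace := (g_sigma_algebraType (@cylinders X)).
Local Notation pr A := (fine (P A)).
Implicit Types (u v w : seq X) (a : X).

Lemma pr_shift (A : set bispace) : measurable A -> pr (shift @^-1` A) = pr A.
Proof. by move=> mA; rewrite Pstat. Qed.

Lemma pr_cylinder w t : pr (cylinder w t) = wprob P w.
Proof.
have step s : pr (cylinder w (s + 1)) = pr (cylinder w s).
  by rewrite -shift_cylinder pr_shift//; exact: measurable_cylinder.
rewrite /wprob; case: t => n.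
  by elim: n => [//|n <-]; rewrite -[RHS]step intS addrC.
elim: n => [|n <-]; rewrite -[LHS]step; first by [].
by rewrite (_ : Negz n.+1 + 1 = Negz n :> int)//; lia.
Qed.

Lemma wprob_ge0 w : 0 <= wprob P w.
Proof. exact: fine_ge0. Qed.

Lemma wprob_nil : wprob P [::] = 1.
Proof.
rewrite /wprob (_ : cylinder _ _ = setT); last by apply/seteqP; split.
by rewrite [P _]probability_setT.
Qed.

Lemma cylinder1 a t : cylinder [:: a] t = [set x : int -> X | x t = a].
Proof.
apply/seteqP; split=> x; rewrite /cylinder /mkseq /= addr0; first by case.
by move=> ->.
Qed.

Lemma pr_letter (A : set bispace) t : measurable A ->
  pr A = \sum_a pr (A `&` cylinder [:: a] t).
Proof.
move=> mA; apply: pr_partition => //.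
- by move=> a; exact: measurable_cylinder.
- by move=> a b _ _ [x []]; rewrite !cylinder1 /= => -> ->.
rewrite (_ : \bigcup_i _ = setT); first exact: probability_setT.
by rewrite -subTset => x _; exists (x t) => //; rewrite cylinder1.
Qed.

Lemma wprob_rconsE w : wprob P w = \sum_a wprob P (rcons w a).
Proof.
rewrite /wprob (pr_letter (size w)%:Z); last exact: measurable_cylinder.
by apply: eq_bigr => a _; rewrite -cats1 cylinder_cat add0r.
Qed.

Lemma wprob_consE w : wprob P w = \sum_a wprob P (a :: w).
Proof.
rewrite -(pr_cylinder w 1) (pr_letter 0); last exact: measurable_cylinder.
by apply: eq_bigr => a _; rewrite setIC /wprob -(cat1s a w) cylinder_cat add0r.
Qed.

Lemma le_wprob_catl u v : wprob P (u ++ v) <= wprob P u.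
Proof.
rewrite /wprob cylinder_cat; apply: le_pr => //; try exact: measurable_cylinder.
by apply: measurableI; exact: measurable_cylinder.
Qed.

Lemma le_wprob_catr u v : wprob P (u ++ v) <= wprob P v.
Proof.
rewrite -(pr_cylinder v (size u)%:Z) /wprob cylinder_cat add0r.
apply: le_pr => //; try exact: measurable_cylinder.
by apply: measurableI; exact: measurable_cylinder.
Qed.

Lemma condprob_ge0 w v : 0 <= condprob P w v.
Proof. by rewrite divr_ge0 ?wprob_ge0. Qed.

Lemma condprob_le1 w v : condprob P w v <= 1.
Proof.
have [v0|v0] := eqVneq (wprob P v) 0; first by rewrite /condprob v0 invr0 mulr0.
by rewrite ler_pdivrMr ?mul1r ?le_wprob_catl// lt_neqAle eq_sym v0 wprob_ge0.
Qed.

Lemma condprobM w v : condprob P w v * wprob P v = wprob P (v ++ w).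
Proof.
have [v0|v0] := eqVneq (wprob P v) 0; last by rewrite divfK.
rewrite v0 mulr0; apply/eqP; rewrite eq_le wprob_ge0 /= -[X in _ <= X]v0.
exact: le_wprob_catl.
Qed.

End Words.

(** * Regular pasts and their classes *)

Section Pasts.
Context {R : realType} {X : alphabetType}.
Variable P : process R X.
Hypothesis Pstat : stationary P.
Notation bispace := (g_sigma_algebraType (@cylinders X)).
Notation pastspace := (g_sigma_algebraType (@past_cylinders X)).
Implicit Types (u v w : seq X) (a : X) (p q : nat -> X).

Lemma future_eq p w l :
  condprob P w (past_word p n) @[n --> \oo] --> l -> future P p w = l.
Proof. by move=> pl; exact: (cvg_lim (@Rhausdorff R) pl). Qed.

Lemma condprob_nil p : regular P p ->
  (fun n => condprob P [::] (past_word p n)) = cst 1.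
Proof.
by move=> [p0 _]; apply: funext => n; rewrite /condprob cats0 divff// gt_eqF.
Qed.

Lemma future_cvg p w : regular P p ->
  condprob P w (past_word p n) @[n --> \oo] --> future P p w.
Proof.
move=> rp; have [->|w0] := eqVneq w [::]; last by case: rp => _ /(_ w w0).
by rewrite /future condprob_nil//; apply: is_cvg_cst.
Qed.
Arguments future_cvg {p} w.

Lemma future_nil p : regular P p -> future P p [::] = 1.
Proof. by move=> rp; apply: future_eq; rewrite condprob_nil//; exact: cvg_cst. Qed.

Lemma future_ge0 p w : regular P p -> 0 <= future P p w.
Proof.
move=> rp; apply: (@ler_cvg_to nat \oo _ R _ _ _ _ (cvg_cst 0) (future_cvg w rp)).
by apply: nearW => n /=; rewrite condprob_ge0.
Qed.

Lemma future_sum p : regular P p -> \sum_a future P p [:: a] = 1.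
Proof.
move=> rp; apply/esym.
have cvs : \sum_a condprob P [:: a] (past_word p n) @[n --> \oo] -->
    \sum_a future P p [:: a].
  apply: (@cvg_big _ _ _ _ _ add_continuous) => a _; exact: future_cvg.
have c1 : \sum_a condprob P [:: a] (past_word p n) @[n --> \oo] --> (1 : R).
  rewrite (_ : (fun n => _) = cst 1); first exact: cvg_cst.
  apply: funext => n; rewrite -mulr_suml /=.
  under eq_bigr do rewrite cats1.
  by rewrite -wprob_rconsE// divff// gt_eqF//; case: rp.
by apply: cvg_unique c1 cvs; exact: Rhausdorff.
Qed.

(** Words starting with an impossible symbol, for which the recursion through
    [delta_h] says nothing. *)
Lemma future_cons0 p a w : regular P p ->
  future P p [:: a] = 0 -> future P p (a :: w) = 0.
Proof.
move=> rp pa0; apply/eqP; rewrite eq_le future_ge0// andbT -pa0.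
apply: (@ler_cvg_to nat \oo _ R _ _ _ _ (future_cvg _ rp) (future_cvg _ rp)).
apply: nearW => n /=; rewrite ler_pM2r ?invr_gt0; last by case: rp.
by rewrite -cat1s catA le_wprob_catl.
Qed.

Lemma past_word_suffix p m n : (m <= n)%N ->
  exists u, past_word p n = u ++ past_word p m.
Proof. by move=> mn; rewrite -(subnKC mn) past_wordD; eexists. Qed.

(** The estimates of P(a | p) converge to a positive number, hence are positive
    for long past words.  The probability of the past word extended by a only
    grows when the past word is shortened, so it is positive for all lengths. *)
Lemma append_wprob_gt0 p a n : regular P p -> 0 < future P p [:: a] ->
  0 < wprob P (past_word (append p a) n.+1).
Proof.
move=> rp pa; rewrite past_word_append.
have [m _ mP] := cvgr_gt _ (future_cvg [:: a] rp) _ pa.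
have pm : 0 < condprob P [:: a] (past_word p (maxn m n)).
  by apply: mP => /=; exact: leq_maxl.
have [u um] := past_word_suffix p (leq_maxr m n).
apply: lt_le_trans (le_wprob_catr Pstat u _).
rewrite -cats1 catA -um.
move: pm; rewrite /condprob pmulr_lgt0// invr_gt0; by case: rp.
Qed.

Lemma condprob_append p a w n : regular P p ->
  condprob P w (past_word (append p a) n.+1) =
  condprob P (a :: w) (past_word p n) / condprob P [:: a] (past_word p n).
Proof.
move=> rp; rewrite past_word_append /condprob cats1 cat_rcons invf_div mulrA divfK//.
by rewrite gt_eqF//; case: rp.
Qed.

(** Passage to the limit in Bayes' rule: the future after p followed by a is
    obtained from the future of p. *)
Lemma append_cvg p a w : regular P p -> 0 < future P p [:: a] ->
  condprob P w (past_word (append p a) n) @[n --> \oo] -->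
  future P p (a :: w) / future P p [:: a].
Proof.
move=> rp pa; rewrite -cvg_shiftS /=.
under eq_fun do rewrite condprob_append//.
apply: cvgM; first exact: future_cvg.
by apply: cvgV; [rewrite gt_eqF|exact: future_cvg].
Qed.

Lemma regular_append p a : regular P p -> 0 < future P p [:: a] ->
  regular P (append p a).
Proof.
move=> rp pa; split=> [[|n]|w w0]; first by rewrite wprob_nil.
- exact: append_wprob_gt0.
- by apply: cvgP; exact: append_cvg.
Qed.

Lemma future_append p a w : regular P p -> 0 < future P p [:: a] ->
  future P (append p a) w = future P p (a :: w) / future P p [:: a].
Proof. by move=> rp pa; apply: future_eq; exact: append_cvg. Qed.

(** Convergence is a countable combination of conditions that each look at one
    past word. *)
Lemma measurable_cvg_past (f : nat -> seq X -> R) (l : R) :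
  measurable ([set p | f n (past_word p n) @[n --> \oo] --> l] : set pastspace).
Proof.
rewrite (_ : mkset _ = \bigcap_k \bigcup_m \bigcap_(n in [set n | (m <= n)%N])
    (past_word^~ n @^-1` [set w | `|l - f n w| < k.+1%:R^-1])); last first.
  apply/seteqP; split=> p /=.
    move=> /cvgrPdist_lt pl k _.
    have [m _ mP] := pl k.+1%:R^-1 ltac:(by rewrite invr_gt0).
    by exists m => // n /mP.
  move=> pl; apply/cvgrPdist_lt => e e0.
  have [k _ kP] := near_infty_natSinv_lt (PosNum e0).
  have [m _ mP] := pl k Logic.I.
  exists m => // n /mP /= /lt_trans; apply; exact: (kP k (leqnn k)).
apply: bigcap_measurableType => k _; apply: bigcupT_measurable => m.
apply: bigcap_measurableType => n _; exact: measurable_past_word.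
Qed.

(** Fixing one regular past of the class turns equality of two limits into
    convergence to given numbers, which shows that the class is measurable. *)
Lemma class_of_pastE p : regular P p ->
  class_of_past P p = [set q | forall n, 0 < wprob P (past_word q n)] `&`
    \bigcap_(w in [set w | w != [::]])
      [set q | condprob P w (past_word q n) @[n --> \oo] --> future P p w].
Proof.
move=> rp; apply/seteqP; split=> q /=.
  move=> [rq pq]; split; first by case: rq.
  by move=> w w0; rewrite (pq w w0); exact: future_cvg.
move=> [q0 qw]; split; last by move=> w w0; rewrite (future_eq (qw w w0)).
by split=> // w /qw /cvgP.
Qed.

Lemma measurable_class (C : set (nat -> X)) :
  equiv_classes P C -> measurable (C : set pastspace).
Proof.
move=> [p rp ->]; rewrite class_of_pastE//; apply: measurableI.
  rewrite (_ : mkset _ =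
    \bigcap_n (past_word^~ n @^-1` [set w | 0 < wprob P w])); last first.
    by apply/seteqP; split=> q /= q0 n; [move=> _|]; exact: q0.
  by apply: bigcap_measurableType => n _; exact: measurable_past_word.
rewrite -[X in measurable X]setCK setC_bigcap; apply: measurableC.
rewrite bigcup_mkcond; apply: countable_bigcupT_measurable => [|w].
  exact: (countableP [set: seq X]).
case: ifP => // _; apply: measurableC.
exact: (@measurable_cvg_past (fun n => condprob P w)).
Qed.

Lemma classP (C : set (nat -> X)) p : equiv_classes P C -> C p ->
  regular P p /\ C = class_of_past P p.
Proof.
move=> [q rq ->] [rp qp]; split=> //.
apply/seteqP; split=> r [rr e]; split=> // w w0.
  by rewrite -(qp w w0) e.
by rewrite (qp w w0) e.
Qed.

Lemma class_has_past (C : set (nat -> X)) : equiv_classes P C -> exists p, C p.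
Proof. by move=> [p rp ->]; exists p; split. Qed.

Lemma class_eq (C D : set (nat -> X)) p : equiv_classes P C ->
  equiv_classes P D -> C p -> D p -> C = D.
Proof. by move=> eC eD /(classP eC)[_ ->] /(classP eD)[_ ->]. Qed.

Lemma class_probE (C : set (nat -> X)) p w : equiv_classes P C -> C p ->
  class_prob P C w = future P p w.
Proof.
move=> eC Cp; have [rp CE] := classP eC Cp.
rewrite /class_prob; case: xgetP => [y _ [q Cq <-]|/(_ (future P p w))]; last first.
  by case; exists p.
have [rq _] := classP eC Cq.
have [->|w0] := eqVneq w [::]; first by rewrite !future_nil.
by move: Cq; rewrite CE => -[_ /(_ w w0)].
Qed.

Lemma delta_hE (C : set (nat -> X)) p a : equiv_classes P C -> C p ->
  0 < class_prob P C [:: a] -> delta_h P C a = class_of_past P (append p a).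
Proof.
move=> eC Cp Ca.
have same q : C q -> class_of_past P (append q a) = class_of_past P (append p a).
  move=> Cq; have [rq CE] := classP eC Cq; have [rp _] := classP eC Cp.
  have qp w : future P (append q a) w = future P (append p a) w.
    by rewrite !future_append// -?(class_probE _ eC)// -!(class_probE _ eC Cp).
  by apply/seteqP; split=> r [rr e]; split=> // w w0; rewrite -(e w w0).
by apply/seteqP; split=> [r [q /same -> //]|r rp]; exists p.
Qed.

Lemma delta_h_class (C : set (nat -> X)) a : equiv_classes P C ->
  0 < class_prob P C [:: a] -> equiv_classes P (delta_h P C a).
Proof.
move=> eC Ca; have [p Cp] := class_has_past eC; have [rp _] := classP eC Cp.
rewrite (delta_hE eC Cp Ca); exists (append p a) => //.
by apply: regular_append => //; rewrite -(class_probE _ eC Cp).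
Qed.

Lemma delta_h_append (C : set (nat -> X)) p a : equiv_classes P C -> C p ->
  0 < class_prob P C [:: a] -> delta_h P C a (append p a).
Proof.
move=> eC Cp Ca; rewrite (delta_hE eC Cp Ca); split=> //.
have [rp _] := classP eC Cp.
by apply: regular_append => //; rewrite -(class_probE _ eC Cp).
Qed.

(** The chain rule for futures; it is what makes the machine emit words with the
    conditional probabilities of the classes. *)
Lemma class_prob_cons (C : set (nat -> X)) a w : equiv_classes P C ->
  0 < class_prob P C [:: a] ->
  class_prob P C (a :: w) =
  class_prob P C [:: a] * class_prob P (delta_h P C a) w.
Proof.
move=> eC Ca; have [p Cp] := class_has_past eC; have [rp _] := classP eC Cp.
rewrite (class_probE _ (delta_h_class eC Ca) (delta_h_append eC Cp Ca)).
move: Ca; rewrite !(class_probE _ eC Cp) => pa.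
by rewrite future_append// mulrC divfK// gt_eqF.
Qed.

End Pasts.

(** * Conditional probabilities given a class *)

Lemma ge0_integral_bigcup_fin d (T : measurableType d) (R : realType)
    (mu : {measure set T -> \bar R}) (I : finType) (B : I -> set T)
    (f : T -> \bar R) :
  (forall i, measurable (B i)) -> trivIset setT B -> measurable_fun setT f ->
  (forall x, 0 <= f x)%E ->
  (\int[mu]_(x in \bigcup_i B i) f x = \sum_i \int[mu]_(x in B i) f x)%E.
Proof.
move=> mB tB mf f0.
have -> : \bigcup_i B i = \big[setU/set0]_(i <- index_enum I) B i.
  rewrite -bigcup_seq; congr (bigcup _ _); apply/seteqP; split=> // i _ /=.
  exact: mem_index_enum.
apply: ge0_integral_bigsetU => //; first exact: index_enum_uniq.
- by apply: sub_trivIset tB.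
- exact: measurable_funTS.
Qed.

(** The pushforward is a measure because [past_of] is measurable; the existential
    hides that proof from the measures it is applied to. *)
Lemma past_image_measure (R : realType) (X : alphabetType)
    (m : {measure set (g_sigma_algebraType (@cylinders X)) -> \bar R}) :
  exists m' : {measure set (g_sigma_algebraType (@past_cylinders X)) -> \bar R},
    forall A, m' A = m (past_of @^-1` A).
Proof.
unshelve refine (ex_intro _ [the {measure set _ -> \bar R} of
  @pushforward _ _ (g_sigma_algebraType _) (g_sigma_algebraType _) _ m past_of] _).
  exact: measurable_past_of.
by [].
Qed.

Section PositiveClasses.
Context {R : realType} {X : alphabetType}.
Variable P : process R X.
Hypothesis Pstat : stationary P.
Hypothesis Pfin : finitely_characterized P.
Context {N : nat} {E : 'I_N -> set (nat -> X)}.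
Hypothesis EP : enumerates_positive_classes P E.
Notation bispace := (g_sigma_algebraType (@cylinders X)).
Notation pastspace := (g_sigma_algebraType (@past_cylinders X)).
Local Notation pr A := (fine (P A)).
Implicit Types (u v w : seq X) (a : X) (p q : nat -> X) (i j : 'I_N).

Lemma past_classes_trivIset (I : eqType) (C : I -> set (nat -> X)) :
  injective C -> (forall k, equiv_classes P (C k)) ->
  trivIset setT (fun k => past_of @^-1` C k).
Proof.
move=> Cinj eC k l _ _ [x [xk xl]]; apply: Cinj.
exact: class_eq (eC k) (eC l) xk xl.
Qed.

Lemma E_positive i : positive_classes P (E i).
Proof. by case: EP => fE _ _; apply: fE. Qed.

Lemma E_class i : equiv_classes P (E i).
Proof. by case: (E_positive i). Qed.

Lemma E_inj : injective E.
Proof. by case: EP => _ Einj _ i j Eij; apply: Einj => //; rewrite inE. Qed.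

Lemma E_surj C : positive_classes P C -> exists i, C = E i.
Proof. by case: EP => _ _ sE /sE[i _ <-]; exists i. Qed.

Definition causal_event i : set (int -> X) := past_of @^-1` E i.
Local Notation causal := causal_event.

Lemma measurable_causal i : measurable (causal i : set bispace).
Proof. by apply: measurable_past_of_preimage; exact: measurable_class (E_class i). Qed.

Lemma causal_trivIset : trivIset setT causal.
Proof. by apply: past_classes_trivIset; [exact: E_inj|exact: E_class]. Qed.

Lemma pr_causal_gt0 i : 0 < pr (causal i).
Proof.
have [_] := E_positive i; rewrite /past_measure /pushforward -/(causal_event i).
by rewrite (prE P (measurable_causal i)) lte_fin.
Qed.

(** Classes of total probability 1 are given; each of them has positive
    probability, so it occurs among the E i. *)
Lemma causal_cover : P (\bigcup_i causal i) = 1%E.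
Proof.
have mU : measurable (\bigcup_i causal i : set bispace).
  apply: fin_bigcup_measurable; first exact: finite_finset.
  by move=> i _; exact: measurable_causal.
apply/eqP; rewrite eq_le; apply/andP; split; first exact: probability_le1.
have [M [C [Cinj Cpos C1]]] := Pfin.
have Cclass k : equiv_classes P (C k) by case: (Cpos k).
have mC k : measurable (past_of @^-1` C k : set bispace).
  by apply: measurable_past_of_preimage; exact: measurable_class (Cclass k).
have <- : P (\bigcup_k (past_of @^-1` C k)) = 1%E.
  by rewrite -C1 measure_bigcup_fin//; exact: past_classes_trivIset.
apply: le_measure; rewrite ?inE//.
  by apply: fin_bigcup_measurable => //; exact: finite_finset.
move=> x [k _ xk]; have [i CE] := E_surj (Cpos k).
by exists i => //; rewrite /causal_event -CE.
Qed.

Lemma pr_causal (A : set bispace) : measurable A ->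
  pr A = \sum_i pr (A `&` causal i).
Proof.
move=> mA; apply: pr_partition => //; [exact: measurable_causal| |exact: causal_cover].
exact: causal_trivIset.
Qed.

Let est w n (x : bispace) : \bar R :=
  (condprob P w (past_word (past_of x) n))%:E.

Let est_measurable w n : measurable_fun setT (est w n).
Proof.
move=> _ Y mY; rewrite setTI.
rewrite (_ : _ @^-1` _ = (fun x => window x (- n%:Z) n) @^-1`
    [set u | Y (condprob P w u)%:E]); first exact: measurable_window.
by apply/seteqP; split=> x /=; rewrite /est past_word_window.
Qed.

Let est_ge0 w n x : (0 <= est w n x)%E.
Proof. by rewrite lee_fin condprob_ge0. Qed.

Let past_event v : set bispace := cylinder v (- (size v)%:Z).

Let measurable_past_event v : measurable (past_event v).
Proof. exact: measurable_cylinder. Qed.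

(** Splitting the event by the symbol that precedes v replaces v by the words av
    and r + 1 by r, and sum_a P(avw) = P(vw).  When r = 0 the estimate is
    constant on the event, with value P(vw) / P(v). *)
Lemma integral_est w v r :
  (\int[P]_(x in past_event v) est w (size v + r) x =
   (wprob P (v ++ w))%:E)%E.
Proof.
elim: r v => [|r IH] v.
  rewrite (eq_integral (cst (condprob P w v)%:E)); last first.
    move=> x; rewrite inE => xv; rewrite /est addn0 past_word_window.
    by rewrite (_ : window _ _ _ = v).
  rewrite integral_cst// [X in (_ * X)%E](prE P (measurable_past_event v)) -EFinM.
  by rewrite (pr_cylinder Pstat) condprobM.
have -> : past_event v = \bigcup_a past_event (a :: v).
  apply/seteqP; split=> [x xv|x [a _]]; last first.
    rewrite /past_event -(cat1s a v) cylinder_cat => -[_] /=.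
    by rewrite [X in cylinder v X](_ : _ = - (size v)%:Z)//; lia.
  exists (x (- (size v).+1%:Z)) => //.
  rewrite /past_event -(cat1s _ v) cylinder_cat cylinder1; split => //=.
  by rewrite [X in cylinder v X](_ : _ = - (size v)%:Z)//; lia.
rewrite ge0_integral_bigcup_fin//; last first.
  move=> a b _ _ [x []]; rewrite /past_event -(cat1s a v) -(cat1s b v).
  by rewrite !cylinder_cat !cylinder1 => -[/= <- _] [/= <- _].
under eq_bigr do rewrite addnS -addSn (IH (_ :: v)).
by rewrite sumEFin (wprob_consE Pstat).
Qed.

(** Pasts in E i are regular with the same futures, so on this domain the
    estimates converge at every point, to one constant, and they are bounded
    by 1: dominated convergence applies. *)
Lemma integral_est_cvg w v i :
  (\int[P]_(x in past_event v `&` causal i) est w n x @[n --> \oo] -->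
   (class_prob P (E i) w * pr (past_event v `&` causal i))%:E)%E.
Proof.
have mD : measurable (past_event v `&` causal i).
  by apply: measurableI => //; exact: measurable_causal.
rewrite EFinM -(prE P mD) -integral_cst//.
have [] := @dominated_convergence _ _ _ P _ mD (est w)
  (cst (class_prob P (E i) w)%:E) (cst 1%E); rewrite //.
- by move=> n; exact: measurable_funTS.
- apply: aeW => x [_ xi] /=; apply: cvg_EFin; first by exact: nearW.
  rewrite /= (class_probE _ (E_class i) xi).
  by apply: future_cvg; case: (classP (E_class i) xi).
- exact: finite_measure_integrable_cst.
- apply: aeW => x n _ /=; rewrite lee_fin ger0_norm ?condprob_ge0//.
  exact: condprob_le1.
Qed.

(** The integral of the estimate over the whole past event no longer depends on
    n once n >= |v|; its limit can be computed on each class separately. *)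
Lemma wprob_cat_causal w v : wprob P (v ++ w) =
  \sum_i class_prob P (E i) w * pr (past_event v `&` causal i).
Proof.
pose D : set bispace := past_event v; pose U : set bispace := \bigcup_i causal i.
have mD : measurable D by exact: measurable_past_event.
have mU : measurable (U : set bispace).
  apply: fin_bigcup_measurable; first exact: finite_finset.
  by move=> i _; exact: measurable_causal.
have DU0 : P (D `\` U) = 0%E by exact: pr_setD_full mD mU causal_cover.
have split n : (\int[P]_(x in D) est w n x =
    \sum_i \int[P]_(x in D `&` causal i) est w n x)%E.
  rewrite -[in LHS](setUIDK D U) ge0_integral_setU//; last 4 first.
  - exact: measurableI.
  - exact: measurableD.
  - exact: measurable_funTS.
  - by apply/disj_setPS => x [[_ ?] []].
  rewrite (null_set_integral (N := D `\` U)) ?adde0//; last 2 first.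
  - exact: measurableD.
  - exact: measurable_funTS.
  rewrite setI_bigcupr ge0_integral_bigcup_fin//.
  - by move=> i; apply: measurableI => //; exact: measurable_causal.
  - by apply: trivIset_setIl; exact: causal_trivIset.
apply: EFin_inj; rewrite -sumEFin.
have cv : (\int[P]_(x in D) est w n x @[n --> \oo] -->
    \sum_i (class_prob P (E i) w * pr (past_event v `&` causal i))%:E)%E.
  under eq_fun do rewrite split.
  apply: cvg_nnesum => i _; last exact: integral_est_cvg.
  by apply: nearW => n; exact: integral_ge0.
have cw : (\int[P]_(x in D) est w n x @[n --> \oo] --> (wprob P (v ++ w))%:E)%E.
  rewrite -(cvg_shiftn (size v)).
  rewrite (_ : (fun n => _) = cst (wprob P (v ++ w))%:E); first exact: cvg_cst.
  by apply: funext => n; rewrite addnC integral_est.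
by apply: cvg_unique cw cv; exact: ereal_hausdorff.
Qed.

(** Both sides are measures in A, and by [wprob_cat_causal] they agree on the
    events that prescribe the last symbols of the past. *)
Lemma pr_past_future (A : set pastspace) w : measurable A ->
  pr (past_of @^-1` A `&` cylinder w 0) =
  \sum_i class_prob P (E i) w * pr (past_of @^-1` A `&` causal i).
Proof.
move=> mA.
have c0 i : 0 <= class_prob P (E i) w.
  have [p Ep] := class_has_past (E_class i).
  by rewrite (class_probE _ (E_class i) Ep) future_ge0//; case: (classP (E_class i) Ep).
have [m1 m1E] := past_image_measure (mrestr P (measurable_cylinder w 0)).
(* [msum] adds measures indexed by natural numbers; the indices that are not
   states are never reached. *)
pose part k : {measure set bispace -> \bar R} := if insub k is Some i
  then mscale (NngNum (c0 i)) (mrestr P (measurable_causal i)) else mzero.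
have [m2 m2M] := past_image_measure (msum part N).
have m2E (B : set pastspace) : measurable B -> m2 B =
    (\sum_i class_prob P (E i) w * pr (past_of @^-1` B `&` causal i))%:E.
  move=> mB; rewrite m2M /= /msum -sumEFin; apply: eq_bigr => i _.
  rewrite /part valK /= /mscale /= /mrestr EFinM; congr (_ * _)%E.
  apply: prE; apply: measurableI; last exact: measurable_causal.
  exact: measurable_past_of_preimage.
have mI (B : set pastspace) : measurable B ->
    measurable (past_of @^-1` B `&` cylinder w 0 : set bispace).
  move=> mB; apply: measurableI; last exact: measurable_cylinder.
  exact: measurable_past_of_preimage.
have m1E' (B : set pastspace) : measurable B ->
    m1 B = (pr (past_of @^-1` B `&` cylinder w 0))%:E.
  by move=> mB; rewrite m1E; exact: (prE P (mI _ mB)).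
suff e : m1 A = m2 A by apply: EFin_inj; rewrite -m1E'// -m2E.
apply: past_measure_unique => // [|v]; first by rewrite m1E' ?ltry.
have mv := @measurable_past_word_eq X (size v) v.
rewrite (m2E _ mv) (m1E' _ mv) past_of_atom.
rewrite -wprob_cat_causal -(pr_cylinder Pstat _ (- (size v)%:Z)).
by rewrite cylinder_cat addNr.
Qed.

(** Distinct classes are disjoint, so for A = E i one term of the sum remains. *)
Lemma pr_causal_future i w :
  pr (causal i `&` cylinder w 0) = pr (causal i) * class_prob P (E i) w.
Proof.
rewrite pr_past_future; last exact: measurable_class (E_class i).
rewrite (bigD1 i)//= setIid mulrC big1 ?addr0// => j ji.
rewrite (_ : _ `&` _ = set0) ?measure0 ?mulr0//.
rewrite -subset0 => x [xi xj]; case/eqP: ji.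
exact: causal_trivIset (ex_intro _ x (conj xj xi)).
Qed.

End PositiveClasses.

(** * Uniqueness of the stationary vector *)

(** Subtract from mu the largest multiple of pi that keeps all coordinates
    nonnegative.  The difference nu is nonnegative, invariant and vanishes at
    some state; invariance propagates a zero of nu backwards along edges, hence
    to every state.  So mu is a multiple of pi, and the sums agree. *)
Lemma stationary_vector_unique (R : realFieldType) N (M : 'M[R]_N)
    (e : rel 'I_N) (pi mu : 'rV[R]_N) :
  (forall i j, 0 <= M i j) -> (forall i j, e i j -> 0 < M i j) ->
  (forall i j, connect e i j) -> (forall i, 0 < pi 0 i) ->
  \sum_i pi 0 i = 1 -> \sum_i mu 0 i = 1 ->
  pi = pi *m M -> mu = mu *m M -> pi = mu.
Proof.
move=> M0 eM conn pi0 pi1 mu1 piM muM.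
have N0 : (0 < N)%N.
  rewrite lt0n; apply/eqP => N0; move: pi1; subst N.
  by rewrite big_ord0 => /esym/eqP; rewrite oner_eq0.
pose i0 := Ordinal N0.
pose ratio i := mu 0 i / pi 0 i.
pose j0 := [arg min_(i < i0) ratio i]%O.
have jmin i : ratio j0 <= ratio i.
  by rewrite /j0; case: arg_minP => // j _; apply.
pose nu := mu - ratio j0 *: pi.
have nuE i : nu 0 i = mu 0 i - ratio j0 * pi 0 i by rewrite !mxE.
have nu0 i : 0 <= nu 0 i.
  by rewrite nuE subr_ge0 -ler_pdivlMr// jmin.
have nuM : nu = nu *m M by rewrite mulmxBl -scalemxAl -piM -muM.
have nuj0 : nu 0 j0 = 0 by rewrite nuE divfK ?subrr// gt_eqF.
have back i j : e i j -> nu 0 j = 0 -> nu 0 i = 0.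
  move=> eij; rewrite [in nu 0 j]nuM mxE => /psumr_eq0P nz.
  have /eqP := nz (fun k _ => mulr_ge0 (nu0 k) (M0 k j)) i isT.
  by rewrite mulf_eq0 (gt_eqF (eM _ _ eij)) orbF => /eqP.
have nuz i : nu 0 i = 0.
  have /connectP[s] := conn i j0; elim: s i => [|k s IH] i /=; first by move=> _ <-.
  by move=> /andP[eik /IH h] /h; exact: back eik.
have muE i : mu 0 i = ratio j0 * pi 0 i.
  by apply/eqP; rewrite -subr_eq0 -nuE nuz.
have r1 : ratio j0 = 1.
  by rewrite -mu1 (eq_bigr _ (fun i _ => muE i)) -mulr_sumr pi1 mulr1.
by apply/rowP => i; rewrite muE r1 mul1r.
Qed.

(** * Events almost surely contained in their shifted preimage *)

Section Ergodicity.
Context {R : realType} {X : alphabetType}.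
Variable P : process R X.
Hypothesis Pstat : stationary P.
Hypothesis Perg : ergodic P.
Notation bispace := (g_sigma_algebraType (@cylinders X)).
Local Notation pr A := (fine (P A)).
Implicit Types A B : set bispace.

Lemma shift_negligible A : P.-negligible A -> P.-negligible (shift @^-1` A).
Proof.
move=> [B [mB B0 AB]]; exists (shift @^-1` B); split.
- exact: measurable_shift_preimage.
- by rewrite Pstat.
- by move=> x /AB.
Qed.

Lemma iter_shift_negligible m A :
  P.-negligible A -> P.-negligible (iter m shift @^-1` A).
Proof.
by elim: m A => // m IH A nA; apply: (IH (shift @^-1` A)); exact: shift_negligible.
Qed.

Lemma measurable_iter_shift m A :
  measurable A -> measurable (iter m shift @^-1` A : set bispace).
Proof.
elim: m A => // m IH A mA; apply: (IH (shift @^-1` A)).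
exact: measurable_shift_preimage.
Qed.

Lemma negligible_pr A : measurable A -> P.-negligible A <-> pr A = 0.
Proof.
move=> mA; split=> [/(negligibleP P mA) -> //|A0].
by apply/(negligibleP P mA); rewrite [LHS](prE P mA) A0.
Qed.

(** By stationarity the two events have the same probability, so their two
    differences have the same probability as well. *)
Lemma subinvariant_negligible A : measurable A ->
  P.-negligible (A `\` shift @^-1` A) -> P.-negligible (shift @^-1` A `\` A).
Proof.
move=> mA; have mS := measurable_shift_preimage mA.
have mD1 := measurableD mA mS; have mD2 := measurableD mS mA.
move=> /(negligible_pr mD1) d0; apply/(negligible_pr mD2).
apply: (@addrI _ (pr (shift @^-1` A `&` A))).
by rewrite -pr_setID// addr0 (pr_shift Pstat mA) (pr_setID P mA mS) d0 addr0 setIC.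
Qed.

(** Ergodicity speaks of events equal to their shifted preimage.  The event L
    that infinitely many shifts lie in A is one, and it differs from A only
    where A differs from one of its iterated preimages, which are null sets. *)
Lemma subinvariant_trivial A : measurable A ->
  P.-negligible (A `\` shift @^-1` A) -> P A = 0%E \/ P A = 1%E.
Proof.
move=> mA out; have into := subinvariant_negligible mA out.
pose S m : set bispace := iter m shift @^-1` A.
have mS m : measurable (S m) by exact: measurable_iter_shift.
have outS m : P.-negligible (A `\` S m).
  elim: m => [|m IH]; first by apply: negligibleS (negligible_set0 P) => x [].
  apply: negligibleS (negligibleU IH (iter_shift_negligible m out)) => x [Ax nSx].
  by have [Smx|] := EM (S m x); [right|left].
have intoS m : P.-negligible (S m `\` A).
  elim: m => [|m IH]; first by apply: negligibleS (negligible_set0 P) => x [].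
  apply: negligibleS (negligibleU IH (iter_shift_negligible m into)) => x [Sx nAx].
  by have [Smx|] := EM (S m x); [left|right].
pose L : set bispace := \bigcap_n \bigcup_(m in [set m | (n <= m)%N]) S m.
have mL : measurable L.
  apply: bigcap_measurableType => n _; apply: bigcup_measurable => m _; exact: mS.
have shL : shift @^-1` L = L.
  apply/seteqP; split=> x Lx n _.
    have [m nm Smx] := Lx n Logic.I; exists m.+1; first exact: leqW.
    by rewrite /S /preimage/= -iterS iterSr.
  have [[//|m] nm Smx] := Lx n.+1 Logic.I; exists m => //.
  by move: Smx; rewrite /S /preimage/= -iterS iterSr.
have AL : P.-negligible (A `\` L).
  apply: negligibleS (negligible_bigcup outS) => x [Ax /existsNP[n nL]].
  by exists n => //; split=> // Snx; apply: nL => _; exists n => /=.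
have LA : P.-negligible (L `\` A).
  apply: negligibleS (negligible_bigcup intoS) => x [Lx nAx].
  by have [m _ Smx] := Lx 0%N Logic.I; exists m.
have -> : P A = P L.
  rewrite (prE P mA) (prE P mL) (pr_setID P mA mL) (pr_setID P mL mA) setIC.
  by move/(negligible_pr (measurableD mA mL)): AL => ->;
    move/(negligible_pr (measurableD mL mA)): LA => ->.
exact: Perg.
Qed.

End Ergodicity.

(** * The history machine *)

Section NonnegativeVectors.
Context {R : realType} {X : alphabetType} {N : nat}.
Variable T : X -> 'M[R]_N.
Hypothesis T_ge0 : forall x i j, 0 <= T x i j.

Lemma word_mx_ge0 w i j : 0 <= word_mx T w i j.
Proof.
elim: w i j => [|a w IH] i j /=; first by rewrite mxE; case: eqP.
by rewrite mxE; apply: sumr_ge0 => k _; rewrite mulr_ge0.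
Qed.

Lemma norm1_word (v : 'rV[R]_N) w : (forall i, 0 <= v 0 i) ->
  norm1 (v *m word_mx T w) = \sum_i v 0 i * \sum_j word_mx T w i j.
Proof.
move=> v0; rewrite /norm1.
under eq_bigr => j _.
  rewrite ger0_norm mxE; last first.
    by apply: sumr_ge0 => i _; rewrite mulr_ge0// word_mx_ge0.
  over.
by rewrite exchange_big /=; apply: eq_bigr => i _; rewrite mulr_sumr.
Qed.

Lemma state_wprobE i w : state_wprob T i w = \sum_j word_mx T w i j.
Proof.
rewrite /state_wprob norm1_word => [|j]; last by rewrite mxE /=; case: eqP.
rewrite (bigD1 i)//= [X in _ + X]big1 => [|j ji].
  by rewrite mxE !eqxx mul1r addr0.
by rewrite mxE (negbTE ji) andbF mul0r.
Qed.

End NonnegativeVectors.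

Section HistoryMachine.
Context {R : realType} {X : alphabetType}.
Variable P : process R X.
Hypothesis Pstat : stationary P.
Hypothesis Perg : ergodic P.
Hypothesis Pfin : finitely_characterized P.
Context {N : nat} {E : 'I_N -> set (nat -> X)}.
Hypothesis EP : enumerates_positive_classes P E.
Notation bispace := (g_sigma_algebraType (@cylinders X)).
Local Notation pr A := (fine (P A)).
Local Notation T := (history_machine P E).
Local Notation causal := (@causal_event X N E).
Local Notation c i := (class_prob P (E i)).
Implicit Types (u v w : seq X) (a : X) (i j : 'I_N).

Let Ecl i : equiv_classes P (E i) := E_class EP i.
Let mcausal i : measurable (causal i : set bispace) := measurable_causal EP i.

Lemma class_prob_ge0 i w : 0 <= c i w.
Proof.
have [p Ep] := class_has_past (Ecl i); have [rp _] := classP (Ecl i) Ep.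
by rewrite (class_probE _ (Ecl i) Ep) future_ge0.
Qed.

Lemma class_prob_nil i : c i [::] = 1.
Proof.
have [p Ep] := class_has_past (Ecl i); have [rp _] := classP (Ecl i) Ep.
by rewrite (class_probE _ (Ecl i) Ep) future_nil.
Qed.

Lemma class_prob_sum i : \sum_a c i [:: a] = 1.
Proof.
have [p Ep] := class_has_past (Ecl i); have [rp _] := classP (Ecl i) Ep.
rewrite -(future_sum rp); apply: eq_bigr => a _.
exact: class_probE (Ecl i) Ep.
Qed.

Lemma class_prob_cons0 i a w : c i [:: a] = 0 -> c i (a :: w) = 0.
Proof.
have [p Ep] := class_has_past (Ecl i); have [rp _] := classP (Ecl i) Ep.
by rewrite !(class_probE _ (Ecl i) Ep); exact: future_cons0.
Qed.

Lemma delta_h_shift i a : 0 < c i [:: a] ->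
  causal i `&` cylinder [:: a] 0 `<=`
  shift @^-1` (past_of @^-1` delta_h P (E i) a).
Proof.
move=> ca x [xi]; rewrite cylinder1 /= past_of_shift => ->.
exact: delta_h_append (Ecl i) xi ca.
Qed.

(** Stationarity gives [delta_h] the probability of its shifted preimage, which
    contains the event of probability P(E i) P(a | E i) that the past is in E i
    and a follows. *)
Lemma delta_h_positive i a : 0 < c i [:: a] ->
  positive_classes P (delta_h P (E i) a).
Proof.
move=> ca; split; first exact: delta_h_class.
have mD : measurable (past_of @^-1` delta_h P (E i) a : set bispace).
  apply: measurable_past_of_preimage.
  exact: measurable_class (delta_h_class Pstat (Ecl i) ca).
rewrite /past_measure /pushforward (prE P mD) lte_fin -(pr_shift Pstat mD).
apply: lt_le_trans (le_pr P _ _ (delta_h_shift ca)).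
- by rewrite (pr_causal_future Pstat Pfin EP) mulr_gt0// (pr_causal_gt0 EP).
- by apply: measurableI => //; exact: measurable_cylinder.
- exact: measurable_shift_preimage.
Qed.

Lemma next_state i a : 0 < c i [:: a] -> exists j, delta_h P (E i) a = E j.
Proof. by move=> /delta_h_positive /(E_surj EP). Qed.

Lemma history_machineE a i j :
  (0 < c i [:: a] /\ delta_h P (E i) a = E j /\ T a i j = c i [:: a]) \/
  ((c i [:: a] = 0 \/ delta_h P (E i) a <> E j) /\ T a i j = 0).
Proof.
rewrite mxE; have := class_prob_ge0 i [:: a]; rewrite le_eqVlt.
case/orP=> [/eqP <-|ca]; first by rewrite ltxx /=; right; split=> //; left.
rewrite ca /=; case: asboolP => d; [by left|by right; split=> //; right].
Qed.

Lemma history_machine_ge0 a i j : 0 <= T a i j.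
Proof.
by have [[/ltW ? [_ ->]]|[_ ->]] := history_machineE a i j.
Qed.

Lemma history_machine_gt0 a i j : 0 < T a i j <->
  0 < c i [:: a] /\ delta_h P (E i) a = E j.
Proof.
have [[ca [d ->]]|[h ->]] := history_machineE a i j; first by split=> // -[].
by rewrite ltxx; split=> // -[ca d]; case: h => // c0; rewrite c0 ltxx in ca.
Qed.

(** Only the column of the class [delta_h] contributes, so this is the chain rule
    for futures read as one step of the machine. *)
Lemma history_machine_step a i w :
  \sum_j T a i j * c j w = c i (a :: w).
Proof.
have := class_prob_ge0 i [:: a]; rewrite le_eqVlt => /orP[/eqP c0|ca].
  rewrite class_prob_cons0// big1// => j _.
  have [[ca _]|[_ ->]] := history_machineE a i j; last exact: mul0r.
  by rewrite -c0 ltxx in ca.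
have [j d] := next_state ca.
rewrite (bigD1 j)//= big1 ?addr0 => [|k kj].
  have [[_ [_ ->]]|[[c0|//] _]] := history_machineE a i j; last by rewrite c0 ltxx in ca.
  by rewrite [RHS](class_prob_cons Pstat)// d.
have [[_ [dk _]]|[_ ->]] := history_machineE a i k; last exact: mul0r.
by case/eqP: kj; apply: (E_inj EP); rewrite -dk.
Qed.

Lemma history_machine_row a i : \sum_j T a i j = c i [:: a].
Proof.
rewrite -history_machine_step; apply: eq_bigr => j _.
by rewrite class_prob_nil mulr1.
Qed.

Lemma word_mx_row w i : \sum_j word_mx T w i j = c i w.
Proof.
elim: w i => [|a w IH] i /=.
  rewrite class_prob_nil (bigD1 i)//= mxE eqxx big1 ?addr0// => j ji.
  by rewrite mxE eq_sym (negbTE ji).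
under eq_bigr do rewrite mxE.
rewrite exchange_big /= -history_machine_step; apply: eq_bigr => k _.
by rewrite -mulr_sumr IH.
Qed.

Lemma history_machine_hmm : is_hmm T.
Proof.
split=> [a i j|i]; first exact: history_machine_ge0.
under eq_bigr do rewrite summxE.
rewrite exchange_big /= -[RHS](class_prob_sum i).
by apply: eq_bigr => a _; exact: history_machine_row.
Qed.

Lemma history_machine_unifilar : unifilar T.
Proof.
move=> i a j k /history_machine_gt0[_ dj] /history_machine_gt0[_ dk].
by apply: (E_inj EP); rewrite -dj.
Qed.

Lemma history_machine_wprob i w : state_wprob T i w = c i w.
Proof. by rewrite (state_wprobE history_machine_ge0) word_mx_row. Qed.

Lemma history_machine_distinct : distinct_states T.
Proof.
move=> i j ij; apply: contrapT => same; case/eqP: ij; apply: (E_inj EP).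
have [p Ep] := class_has_past (Ecl i); have [rp pE] := classP (Ecl i) Ep.
have [q Eq] := class_has_past (Ecl j); have [rq qE] := classP (Ecl j) Eq.
have e w : w != [::] -> future P p w = future P q w.
  move=> w0; rewrite -(class_probE _ (Ecl i) Ep) -(class_probE _ (Ecl j) Eq).
  rewrite -!history_machine_wprob; apply: contrapT => ne; apply: same.
  by exists w.
apply: (class_eq (Ecl i) (Ecl j) Ep); rewrite qE; split=> // w w0.
by rewrite e.
Qed.

Lemma pr_impossible i a (B : set bispace) : c i [:: a] = 0 -> measurable B ->
  pr ((causal i `&` cylinder [:: a] 0) `&` B) = 0.
Proof.
move=> c0 mB; apply/eqP; rewrite eq_le pr_ge0 andbT.
rewrite -(mulr0 (pr (causal i))) -c0 -(pr_causal_future Pstat Pfin EP).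
have mI : measurable (causal i `&` cylinder [:: a] 0 : set bispace).
  by apply: measurableI => //; exact: measurable_cylinder.
by apply: le_pr => //; exact: measurableI.
Qed.

(** Summed over i and a this shows that the class probabilities are stationary
    for the machine. *)
Lemma pr_transition i a j :
  pr ((causal i `&` cylinder [:: a] 0) `&` shift @^-1` causal j) =
  pr (causal i) * T a i j.
Proof.
have [[ca [d ->]]|[h ->]] := history_machineE a i j.
  rewrite -(pr_causal_future Pstat Pfin EP) setIidl//.
  by rewrite /causal_event -d; exact: delta_h_shift.
rewrite mulr0; have := class_prob_ge0 i [:: a]; rewrite le_eqVlt => /orP[/eqP c0|ca].
  by rewrite pr_impossible//; exact: measurable_shift_preimage.
rewrite (_ : _ `&` _ = set0) ?measure0// -subset0 => x [xia xj].
case: h => [c0|]; first by rewrite c0 ltxx in ca.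
apply; exact: class_eq (delta_h_class Pstat (Ecl i) ca) (Ecl j)
  (delta_h_shift ca xia) xj.
Qed.

Definition causal_dist : 'rV[R]_N := \row_j pr (causal j).

Lemma pr_causal_letter (A : set bispace) : measurable A ->
  pr A = \sum_i \sum_a pr ((causal i `&` cylinder [:: a] 0) `&` A).
Proof.
move=> mA; rewrite (pr_causal Pfin EP)//; apply: eq_bigr => i _.
rewrite (pr_letter P 0); last exact: measurableI.
by apply: eq_bigr => a _; rewrite -setIA setIC.
Qed.

Lemma sum_pr_causal : \sum_i pr (causal i) = 1.
Proof.
have := pr_causal Pfin EP measurableT; rewrite [P setT]probability_setT => /= ->.
by apply: eq_bigr => i _; rewrite setTI.
Qed.

Lemma causal_dist_stationary : stationary_distribution T causal_dist.
Proof.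
split=> [j||]; first by rewrite mxE pr_ge0.
  by rewrite -[RHS]sum_pr_causal; apply: eq_bigr => j _; rewrite mxE.
apply/rowP => j; rewrite !mxE -(pr_shift Pstat (mcausal j)).
rewrite (pr_causal_letter (measurable_shift_preimage (mcausal j))).
apply: eq_bigr => i _; rewrite summxE mulr_sumr mxE.
by apply: eq_bigr => a _; exact: pr_transition.
Qed.

(** Let A be the event that the past lies in a class reachable from i.  A symbol
    of positive conditional probability leads from such a class to another such class,
    so A is almost surely contained in its shifted preimage.  It contains the
    event of E i, so by ergodicity it has probability 1, and then the disjoint
    event of an unreachable class would be null. *)
Lemma history_machine_connected : strongly_connected T.
Proof.
move=> i j.
pose C := [set k | connect (hmm_edge T) i k].
pose A : set bispace := \bigcup_(k in C) causal k.
have mA : measurable A.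
  by apply: fin_bigcup_measurable => //; exact: finite_finset.
have mS := measurable_shift_preimage mA.
have escape : P.-negligible (A `\` shift @^-1` A).
  apply/(negligible_pr P (measurableD mA mS)).
  rewrite (pr_causal_letter (measurableD mA mS)); apply: big1 => k _; apply: big1 => a _.
  have := class_prob_ge0 k [:: a]; rewrite le_eqVlt => /orP[/eqP c0|ca].
    by rewrite pr_impossible//; exact: measurableD.
  rewrite (_ : _ `&` _ = set0) ?measure0// -subset0 => x [xka [[l Cl xl] nSx]].
  have kl : l = k.
    by apply: (E_inj EP); exact: class_eq (Ecl l) (Ecl k) xl xka.1.
  have [m d] := next_state ca.
  apply: nSx; exists m; last by rewrite /causal_event -d; exact: (delta_h_shift ca).
  move: Cl; rewrite kl => /connect_trans; apply; apply: connect1.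
  by apply/existsP; exists a; apply/history_machine_gt0.
have iA : causal i `<=` A by move=> x xi; exists i => //; exact: connect0.
case: (subinvariant_trivial Pstat Perg mA escape) => [A0|A1].
  have := le_pr P (mcausal i) mA iA.
  by rewrite [P A]A0 leNgt (pr_causal_gt0 EP).
apply: contrapT => nCj.
have jA : causal j `<=` ~` A.
  move=> x xj [k Ck xk]; apply: nCj; rewrite (_ : j = k)//.
  by apply: (E_inj EP); exact: class_eq (Ecl j) (Ecl k) xj xk.
have := le_pr P (mcausal j) (measurableC mA) jA.
by rewrite [P (~` A)]probability_setC// [X in (_ - X)%E]A1 subee// leNgt (pr_causal_gt0 EP).
Qed.

Lemma history_machine_wprob_mix w :
  norm1 (causal_dist *m word_mx T w) = wprob P w.
Proof.
rewrite (norm1_word history_machine_ge0) => [|i]; last by rewrite mxE pr_ge0.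
rewrite /wprob (pr_causal Pfin EP); last exact: measurable_cylinder.
apply: eq_bigr => i _.
by rewrite setIC (pr_causal_future Pstat Pfin EP) mxE word_mx_row.
Qed.

Lemma causal_dist_unique : unique (stationary_distribution T) causal_dist.
Proof.
split=> [|mu [_ mu1 muT]]; first exact: causal_dist_stationary.
have [_ pi1 piT] := causal_dist_stationary.
apply: (@stationary_vector_unique _ _ (\sum_a T a) (hmm_edge T)) => //.
- by move=> i j; rewrite summxE sumr_ge0// => a _; exact: history_machine_ge0.
- move=> i j /existsP[a Ta]; rewrite summxE (bigD1 a)//= ltr_wpDr//.
  by rewrite sumr_ge0// => b _; exact: history_machine_ge0.
- exact: history_machine_connected.
- by move=> i; rewrite mxE (pr_causal_gt0 EP).
Qed.

Lemma generates_history_machine : generates T P.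
Proof.
split=> //; exists causal_dist; first exact: causal_dist_unique.
by move=> w _; rewrite history_machine_wprob_mix.
Qed.

(** The stationary vector from which P' is generated can only be the vector of
    class probabilities. *)
Lemma generated_same_process (P' : process R X) :
  generates T P' -> same_process P' P.
Proof.
move=> [P'stat _ [mu [_ muU] P'w]]; apply: process_unique => w t.
have mw := @measurable_cylinder X w t.
rewrite (prE P mw) (prE P' mw) !pr_cylinder//; congr EFin.
have [->|w0] := eqVneq w [::]; first by rewrite !wprob_nil.
by rewrite P'w// -history_machine_wprob_mix (muU _ causal_dist_stationary).
Qed.

End HistoryMachine.

Theorem theorem2 (R : realType) (X : alphabetType) (P : process R X)
    (Pstat : stationary P) (Perg : ergodic P)
    (Pfin : finitely_characterized P)
    (N : nat) (E : 'I_N -> set (nat -> X))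
    (EP : enumerates_positive_classes P E) :
  generator_epsilon_machine (history_machine P E) /\
  (generates (history_machine P E) P /\
   forall P' : process R X,
     generates (history_machine P E) P' -> same_process P' P).
Proof.
split; first split.
- exact: history_machine_hmm.
- exact: history_machine_connected.
- exact: history_machine_unifilar.
- exact: history_machine_distinct.
split; first exact: generates_history_machine.
exact: generated_same_process.
Qed.
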